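(* If ${\rm CLU\#P}={\rm CLU\#P_{circular}}$, then for every $f\in{\rm CLU\#P}$ there is a strictly positive function $g\in{\rm FP}_{\rm t}$, $g:\Sigma^*\to\mathbb{N}$ (i.e., $g(x)>0$ for all $x$), such that $f+g\in{\rm CLU\#P}$.
   Context: Alphabet $\Sigma=\{0,1\}$; NPTM = nondeterministic polynomial-time Turing machine. For a polynomial $p$, an NPTM $M$ is $p$-balanced if on every input $x$ its computation paths correspond exactly to the guess strings in $\{0,1\}^{p(|x|)}$; paths are identified with guess strings. $\mathrm{acc}_M(x)$ is the set of accepting paths, $\#\mathrm{acc}_M(x)$ its size. ${\rm FP}_{\rm t}$: total polynomial-time computable functions. For same-length strings, $a\prec_{\rm lex}b$ means $b$ is the immediate lexicographic successor of $a$; $\le_{\rm lex}$ is lexicographic order. ${\rm CLU\#P}$: total $f:\Sigma^*\to\mathbb{N}$ such that there exist a polynomial $p$, a $p$-balanced NPTM $M$, $b,t\in{\rm FP}_{\rm t}$ and a polynomial-time 3-argument predicate $\prec$ such that for every $x$ there is a bijection $h_x$ of $\Sigma^{p(|x|)}$ with: $|b(x)|=|t(x)|=p(|x|)$; $h_x(b(x))=0^{p(|x|)}$, $h_x(t(x))=1^{p(|x|)}$; (adjacency) for $y,z\in\{0,1\}^{p(|x|)}$, $\prec(x,y,z)$ iff $h_x(y)\prec_{\rm lex}h_x(z)$; (cluster) if $f(x)\neq0$ there exist $\ell,u$ with $\mathrm{acc}_M(x)=\{w\in\{0,1\}^{p(|x|)}: h_x(\ell)\le_{\rm lex}h_x(w)\le_{\rm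 lex}h_x(u)\}$; $f(x)=\#\mathrm{acc}_M(x)$. ${\rm CLU\#P_{circular}}$: defined like ${\rm CLU\#P}$ but with no functions $b,t$ and with adjacency condition: $\prec(x,y,z)$ iff $h_x(y)\prec_{\rm lex}h_x(z)$ or ($h_x(y)=1^{p(|x|)}$ and $h_x(z)=0^{p(|x|)}$). *)

(* Defs.v *)
From mathcomp Require Import all_boot all_order all_algebra perm.
From mathcomp Require Import boolp.
Set Implicit Arguments.
Unset Strict Implicit.
Unset Printing Implicit Defensive.

Notation word := (seq bool).
(* Strings of length n, carrying the lexicographic order with false < true. *)
Notation str n := (n.-tuplelexi bool).

Definition lex_succ n (a b : str n) : bool :=
  (a < b)%O && [forall c : str n, ~~ ((a < c)%O && (c < b)%O)].

(* A cell is blank ([None]), a bit, or an auxiliary work symbol from G. *)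
Definition symbol (G : Type) := option (bool + G).

Inductive direction := MoveLeft | Stay | MoveRight.

(* [lhs] lists the cells to the left of the head, nearest first, and [rhs] the
   cells to its right; all cells beyond either list are blank. *)
Record tape (G : Type) := Tape {
  lhs : seq (symbol G); cur : symbol G; rhs : seq (symbol G) }.

Definition move_left G (t : tape G) : tape G :=
  Tape (behead (lhs t)) (head None (lhs t)) (cur t :: rhs t).

Definition move_right G (t : tape G) : tape G :=
  Tape (cur t :: lhs t) (head None (rhs t)) (behead (rhs t)).

Definition write_move G (a : symbol G * direction) (t : tape G) : tape G :=
  let t' := Tape (lhs t) a.1 (rhs t) in
  match a.2 with
  | MoveLeft => move_left t' | Stay => t' | MoveRight => move_right t'
  end.

Definition tape_of_word G (w : word) : tape G :=
  let s := [seq Some (inl b) | b <- w] in Tape [::] (head None s) (behead s).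

Fixpoint leading_bits G (s : seq (symbol G)) : word :=
  if s is Some (inl b) :: s' then b :: leading_bits s' else [::].

Definition word_of_tape G (t : tape G) : word := leading_bits (cur t :: rhs t).

(* What the transition table prescribes: halting (accepting iff the boolean is
   true), one deterministic step, or a binary nondeterministic choice. *)
Inductive instruction (A : Type) :=
  | Halt of bool
  | Step of A
  | Branch of A & A.
Arguments Halt {A} _.

(* The machine has [ntape.+1] tapes. *)
Record machine := Machine {
  ntape : nat;
  aux : finType;
  state : finType;
  start : state;
  delta : state -> {ffun 'I_ntape.+1 -> symbol aux} ->
    instruction (state * {ffun 'I_ntape.+1 -> symbol aux * direction}) }.

Record config (M : machine) := Config {
  cstate : state M;
  ctape : {ffun 'I_(ntape M).+1 -> tape (aux M)} }.

(* The i-th argument is written on tape i, and the other tapes are blank. *)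
Definition init (M : machine) (args : seq word) : config M :=
  Config (start M)
    [ffun i : 'I_(ntape M).+1 => tape_of_word (aux M) (nth [::] args i)].

(* The output stands on tape 0, from the head up to the first non-bit cell. *)
Definition output (M : machine) (c : config M) : word :=
  word_of_tape (ctape c ord0).

Definition current (M : machine) (c : config M) :=
  delta (cstate c) [ffun i => cur (ctape c i)].

Definition perform (M : machine) (c : config M)
    (a : state M * {ffun 'I_(ntape M).+1 -> symbol (aux M) * direction}) :
    config M :=
  Config a.1 [ffun i => write_move (a.2 i) (ctape c i)].

(* [reaches s c w c']: some computation of exactly s steps leads from c to c',
   and w lists the choices made at its branching points. *)
Inductive reaches (M : machine) :
    nat -> config M -> word -> config M -> Prop :=
  | reaches_refl c : reaches 0 c [::] c
  | reaches_step s c a w c' :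
      current c = Step a -> reaches s (perform c a) w c' ->
      reaches s.+1 c w c'
  | reaches_branch s c a0 a1 b w c' :
      current c = Branch a0 a1 ->
      reaches s (perform c (if b then a1 else a0)) w c' ->
      reaches s.+1 c (b :: w) c'.

Definition deterministic (M : machine) : Prop :=
  forall (q : state M) r a0 a1, delta q r <> Branch a0 a1.

Definition FPt (F : word -> word) : Prop :=
  exists (M : machine) (q : {poly nat}), deterministic M /\
    forall x, exists s (c : config M) b,
      [/\ s <= q.[size x]%R, reaches s (init M [:: x]) [::] c,
          current c = Halt b & output c = F x].

Definition poly_time_pred3 (P : word -> word -> word -> bool) : Prop :=
  exists (M : machine) (q : {poly nat}), deterministic M /\
    forall x y z, exists s (c : config M),
      [/\ s <= q.[(size x + size y + size z)%N]%R,
          reaches s (init M [:: x; y; z]) [::] c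
        & current c = Halt (P x y z)].

(* Binary notation, most significant bit first, no superfluous leading zero. *)
Definition binary_numeral (w : word) (n : nat) : bool :=
  ((w == [:: false]) || head false w) &&
  (foldl (fun (m : nat) (b : bool) => m.*2 + b) 0 w == n).

Definition FPt_nat (g : word -> nat) : Prop :=
  exists F, FPt F /\ forall x, binary_numeral (F x) (g x).

Definition NPTM (M : machine) : Prop :=
  exists q : {poly nat}, forall x s w (c : config M),
    reaches s (init M [:: x]) w c -> s <= q.[size x]%R.

(* The guess strings of the complete computation paths on x are exactly the
   strings of length p(|x|). *)
Definition balanced (p : {poly nat}) (M : machine) : Prop :=
  forall x w,
    (exists s (c : config M) b,
       reaches s (init M [:: x]) w c /\ current c = Halt b) <->
    size w = p.[size x]%R.

Definition accepting_path (M : machine) (x w : word) : Prop :=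
  exists s (c : config M),
    reaches s (init M [:: x]) w c /\ current c = Halt true.

Definition acc (p : {poly nat}) (M : machine) (x : word) :
    {set str (p.[size x]%R)} :=
  [set w : str (p.[size x]%R) | `[< accepting_path M x w >]].

Definition cluster n (h : {perm (str n)}) (A : {set str n}) : Prop :=
  exists l u : str n, A = [set w | (h l <= h w)%O && (h w <= h u)%O].

Definition is_zeros n (a : str n) : bool := all negb a.
Definition is_ones n (a : str n) : bool := all id a.

Definition CLUsharpP (f : word -> nat) : Prop :=
  exists (p : {poly nat}) (M : machine) (b t : word -> word)
         (prec : word -> word -> word -> bool),
    [/\ NPTM M /\ balanced p M, FPt b, FPt t, poly_time_pred3 prec &
      forall x, exists h : {perm (str (p.[size x]%R))},
        [/\ (size (b x) = p.[size x]%R /\ size (t x) = p.[size x]%R),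
            (forall y : str (p.[size x]%R), b x = y -> is_zeros (h y)) /\
            (forall y : str (p.[size x]%R), t x = y -> is_ones (h y)),
            forall y z : str (p.[size x]%R),
              prec x y z <-> lex_succ (h y) (h z),
            f x <> 0 -> cluster h (acc p M x)
          & f x = #|acc p M x|]].

Definition CLUsharpP_circular (f : word -> nat) : Prop :=
  exists (p : {poly nat}) (M : machine)
         (prec : word -> word -> word -> bool),
    [/\ NPTM M /\ balanced p M, poly_time_pred3 prec &
      forall x, exists h : {perm (str (p.[size x]%R))},
        [/\ forall y z : str (p.[size x]%R),
              prec x y z <->
              lex_succ (h y) (h z) \/ (is_ones (h y) /\ is_zeros (h z)),
            f x <> 0 -> cluster h (acc p M x)
          & f x = #|acc p M x|]].

(* Main.v *)
(** The complement of an interval of a cycle is again an interval of that cycle.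
    Given f in CLU#P with path length p, arrange the strings c0 c1 w, where
    |w| = p(|x|), on a cycle made of four copies of the given order, traversed
    alternately forwards and backwards. Adjacency on this cycle is decidable in
    polynomial time, because a step from one copy to the next keeps w and happens
    exactly at w = t(x) or w = b(x). Accepting everything except the strings 00w
    with w accepted shows that 2^(p+2) - f is in CLU#P_circular = CLU#P, say with
    path length q. As 2^(p+2) - f >= 3 * 2^p, we have q >= p + 2. Complementing once
    more gives 2^(q+2) - 2^(p+2) + f, and g = 2^(q+2) - 2^(p+2) has the binary
    notation 1^(q-p) 0^(p+2), computed from the least strings b(x) of the two orders,
    which have lengths p(|x|) and q(|x|). *)

From HB Require Import structures.
Require Import Defs.
From mathcomp Require Import all_boot all_order all_algebra perm.
From mathcomp Require Import boolp zify.
Set Implicit Arguments.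
Unset Strict Implicit.
Unset Printing Implicit Defensive.

Import Order.TTheory GRing.Theory.

(** * Tapes and deterministic programs *)

(* The head is at cell 0 and a move shifts the contents, so that tapes differing
   only in trailing blanks become equal. *)
Definition vtape (G : Type) := int -> symbol G.

Definition offset (d : direction) : int :=
  match d with MoveLeft => -1 | Stay => 0 | MoveRight => 1 end%R.

Definition vact G (a : symbol G * direction) (t : vtape G) : vtape G :=
  fun k => let k' := (k + offset a.2)%R in if k' == 0%R then a.1 else t k'.

Definition cells G (t : tape G) : vtape G := fun k =>
  match k with
  | Posz 0 => cur t
  | Posz n.+1 => nth None (rhs t) n
  | Negz n => nth None (lhs t) n
  end.

Definition wtape G (w : word) : vtape G := fun k =>
  if k is Posz n then nth None [seq Some (inl b) | b <- w] n else None.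
Arguments wtape {G} w.

Definition shift G (d : int) (t : vtape G) : vtape G := fun k => t (k + d)%R.

Lemma cells_write_move G a (t : tape G) :
  cells (write_move a t) = vact a (cells t).
Proof.
apply: funext => k; case: a => s [] /=; rewrite /vact /=.
- case: k => [[|n]|n] /=.
  + by case: (lhs t).
  + have -> : (Posz n.+1 + -1 = Posz n)%R by lia.
    by case: n.
  + by rewrite addn0 nth_behead.
- by rewrite addr0; case: k => [[|n]|n].
- case: k => [[|n]|[|n]] /=.
  + by case: (rhs t).
  + by rewrite addn1 nth_behead.
  + by [].
  + by rewrite subn1.
Qed.

Lemma cells_word G w : cells (tape_of_word G w) = wtape w.
Proof. by apply: funext => -[[|n]|n] //; case: w => //=; case: n. Qed.

Lemma vact_stay G (t : vtape G) : vact (t 0%R, Stay) t = t.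
Proof. by apply: funext => k; rewrite /vact /= addr0; case: eqP => [->|]. Qed.

Lemma vact_move G d (t : vtape G) : vact (t 0%R, d) t = shift (offset d) t.
Proof. by apply: funext => k; rewrite /vact /shift /=; case: eqP => [->|]. Qed.

Lemma vact_pop G w : vact (None, MoveRight) (wtape w) = wtape (behead w) :> vtape G.
Proof.
apply: funext => k; rewrite /vact /=; case: k => [n|[|n]] //.
  have -> : (Posz n + 1 = Posz n.+1)%R by lia.
  by rewrite /= -nth_behead behead_map.
Qed.

(* The word [u] is what [output] would read from [t]. *)
Fixpoint shows G (t : vtape G) (u : word) : Prop :=
  if u is b :: u' then t 0%R = Some (inl b) /\ shows (shift 1 t) u'
  else forall b, t 0%R <> Some (inl b).

Lemma shows_inj G (t : vtape G) u v : shows t u -> shows t v -> u = v.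
Proof.
elim: u v t => [|a u IH] [|b v] t //=.
- by move=> h [/h].
- by case=> e _ /(_ a).
- by case=> -> h [[->]] /(IH _ _ h) ->.
Qed.

Lemma shows_word_of_tape G (t : tape G) : shows (cells t) (word_of_tape t).
Proof.
rewrite /word_of_tape.
have H (s : seq (symbol G)) (v : vtape G) :
    (forall n, v (Posz n) = nth None s n) -> shows v (leading_bits s).
  elim: s v => [|[[b|g]|] s IH] v Hv //=.
  - by move=> b; rewrite (Hv 0).
  - split; first exact: (Hv 0).
    apply: IH => n; rewrite /shift.
    have -> : (Posz n + 1 = Posz n.+1)%R by lia.
    by rewrite Hv.
  - by move=> b; rewrite (Hv 0).
  - by move=> b; rewrite (Hv 0).
by apply: H => -[|n].
Qed.

Lemma shows_wtape G w : shows (wtape w : vtape G) w.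
Proof.
elim: w => [|b w IH] //=; split=> //.
rewrite (_ : shift 1 _ = vact (wtape (b :: w) 0%R, MoveRight) (wtape (b :: w))); last first.
  by rewrite vact_move.
(* The shifted tape still carries [b] at cell -1, so it is not [wtape w]; [shows] inspects only
   nonnegative cells, where the two agree. *)
suff E : forall k, (0 <= k)%R -> vact (wtape (b :: w) 0%R, MoveRight) (wtape (b :: w)) k = wtape w k :> symbol G.
  move: IH; move: (wtape w) (vact _ _) E => t t' E.
  elim: {b} w t t' E => [|b w IH] t t' E /=; rewrite E //.
  case=> -> h; split=> //; apply: IH h => k hk; rewrite /shift E //; lia.
case=> // n _; rewrite /vact.
by have -> : (Posz n + offset MoveRight = Posz n.+1)%R by rewrite /=; lia.
Qed.

(** * Programs over an arbitrary tape index and their sequencing *)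

Section Programs.

Variables I G : Type.

(* [inl b] means: halt with answer b. *)
Record prog := Prog {
  pstate : finType;
  pstart : pstate;
  pdelta : pstate -> (I -> symbol G) ->
    bool + pstate * (I -> symbol G * direction) }.

Definition heads (T : I -> vtape G) : I -> symbol G := fun j => T j 0%R.

Definition act (a : I -> symbol G * direction) (T : I -> vtape G) :=
  fun j => vact (a j) (T j).

Inductive runs (P : prog) :
    nat -> pstate P -> (I -> vtape G) -> bool -> (I -> vtape G) -> Prop :=
  | runs_halt q T b : pdelta q (heads T) = inl b -> runs 0 q T b T
  | runs_step s q T q' a b T' : pdelta q (heads T) = inr (q', a) ->
      runs s q' (act a T) b T' -> runs s.+1 q T b T'.

Definition runs_in (P : prog) n T b T' :=
  exists2 s, s <= n & runs s (pstart P) T b T'.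

Lemma runs_in_leq P m n T b T' :
  m <= n -> runs_in P m T b T' -> runs_in P n T b T'.
Proof. by move=> h [s hs r]; exists s => //; apply: leq_trans h. Qed.

Definition idle (r : I -> symbol G) : I -> symbol G * direction :=
  fun j => (r j, Stay).

Lemma act_idle T : act (idle (heads T)) T = T.
Proof. by apply: funext => j; rewrite /act /idle /heads vact_stay. Qed.

(** An answer of [A] does not halt the composite: one idle step passes control on, whence the
    successor in the time bounds. *)
Definition cond (A B1 B0 : prog) : prog :=
  @Prog (pstate A + (pstate B1 + pstate B0))%type (inl (pstart A))
    (fun q r => match q with
     | inl q => match pdelta q r with
       | inl b => inr (inr (if b then inl (pstart B1) else inr (pstart B0)), idle r)
       | inr (q', a) => inr (inl q', a)
       end
     | inr (inl q) => match pdelta q r with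
       | inl b => inl b | inr (q', a) => inr (inr (inl q'), a) end
     | inr (inr q) => match pdelta q r with
       | inl b => inl b | inr (q', a) => inr (inr (inr q'), a) end
     end).

Lemma cond_runs A B1 B0 m n T b T' b' T'' :
  runs_in A m T b T' -> runs_in (if b then B1 else B0) n T' b' T'' ->
  runs_in (cond A B1 B0) (m + n).+1 T b' T''.
Proof.
case=> s hs rA [s' hs' rB]; exists (s + s').+1; first by rewrite ltnS leq_add.
have {hs' rB}: runs (P := cond A B1 B0) s'
    (inr (if b then inl (pstart B1) else inr (pstart B0))) T' b' T''.
  by case: b {rA} rB => /=; elim=> [??? e|??????? e _ IH];
    do [by constructor => /=; rewrite e | by apply: runs_step IH => /=; rewrite e].
move=> h; change (runs (P := cond A B1 B0) (s + s').+1 (inl (pstart A)) T b' T''); move: h.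
elim: rA {hs} => {s T b T'} [q T b e|s q T q' a b T' e _ IH] h.
  rewrite add0n; apply: (runs_step (P := cond A B1 B0)); first by rewrite /= e.
  by rewrite act_idle.
rewrite addSn; apply: (runs_step (P := cond A B1 B0)); first by rewrite /= e.
exact: IH.
Qed.

Definition andthen (A B : prog) : prog := cond A B B.

Lemma andthen_runs A B m n T b T' b' T'' :
  runs_in A m T b T' -> runs_in B n T' b' T'' ->
  runs_in (andthen A B) (m + n).+1 T b' T''.
Proof. by move=> rA rB; apply: (cond_runs rA); case: b {rA}. Qed.

(** The continuation depends on the answer, so bits read earlier are remembered in the choice of
    program. *)
Definition branch (A : prog) (K : bool -> prog) : prog := cond A (K true) (K false).

Lemma branch_runs A K m n T b T' b' T'' :
  runs_in A m T b T' -> runs_in (K b) n T' b' T'' ->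
  runs_in (branch A K) (m + n).+1 T b' T''.
Proof. by move=> rA rB; apply: (cond_runs rA); case: b rB {rA}. Qed.

Definition const (b : bool) : prog := @Prog unit tt (fun _ _ => inl b).

Lemma const_runs b T : runs_in (const b) 0 T b T.
Proof. by exists 0 => //; constructor. Qed.

End Programs.
Arguments const {I G} b.
Arguments runs {I G} P.

(** * Simulating a machine inside a larger set of tapes *)

Section Lift.

Variables (A : machine) (I G : finType).
Variables (e : 'I_(ntape A).+1 -> I) (enc : aux A -> G).
Hypotheses (e_inj : injective e) (enc_inj : injective enc).

Definition enc_symbol (s : symbol (aux A)) : symbol G :=
  match s with
  | Some (inl b) => Some (inl b) | Some (inr a) => Some (inr (enc a))
  | None => None
  end.

Definition dec_symbol (s : symbol G) : symbol (aux A) :=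
  match s with
  | Some (inl b) => Some (inl b)
  | Some (inr g) => omap inr [pick a | enc a == g]
  | None => None
  end.

Lemma enc_symbolK : cancel enc_symbol dec_symbol.
Proof.
move=> [[b|a]|] //=; case: pickP => [a' /eqP/enc_inj -> //|/(_ a)].
by rewrite eqxx.
Qed.

Definition enc_tape (t : vtape (aux A)) : vtape G := fun k => enc_symbol (t k).

Lemma enc_tape_act a t :
  enc_tape (vact a t) = vact (enc_symbol a.1, a.2) (enc_tape t).
Proof. by apply: funext => k; rewrite /enc_tape /vact /=; case: eqP. Qed.

Lemma enc_tape_word w : enc_tape (wtape w) = wtape w.
Proof.
apply: funext => -[n|n] //; rewrite /enc_tape /=.
by elim: w n => [|b w IH] [|n] //=.
Qed.

Lemma shows_enc t u : shows t u -> shows (enc_tape t) u.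
Proof.
elim: u t => [|b u IH] t /=; rewrite {1}/enc_tape.
  by move=> h b; case: (t 0%R) h => [[b'|a]|] h //= [E]; apply: (h b'); rewrite E.
by case=> -> h; split=> //; apply: (IH (shift 1 t)).
Qed.

(** A branching instruction gets a dummy answer, since only runs with an empty choice word are
    simulated. *)
Definition lift : prog I G :=
  @Prog I G (state A) (start A) (fun q r =>
    match delta q [ffun i => dec_symbol (r (e i))] with
    | Halt b => inl b
    | Step a => inr (a.1, fun j =>
        if [pick i | e i == j] is Some i then (enc_symbol (a.2 i).1, (a.2 i).2)
        else (r j, Stay))
    | Branch _ _ => inl false
    end).

Definition holds (c : config A) (T : I -> vtape G) : Prop :=
  forall i, T (e i) = enc_tape (cells (ctape c i)).

Lemma pick_e i : [pick i' | e i' == e i] = Some i.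
Proof. by case: pickP => [i' /eqP/e_inj -> //|/(_ i)]; rewrite eqxx. Qed.

Lemma lift_current c T : holds c T ->
  [ffun i => dec_symbol (heads T (e i))] = [ffun i => cur (ctape c i)].
Proof.
by move=> h; apply/ffunP => i; rewrite !ffunE /heads h /enc_tape enc_symbolK.
Qed.

(** The last clause is a frame property: tapes outside the range of [e] survive, so subroutines can
    be run one after another on common tapes. *)
Lemma lift_runs s c c' b T :
  reaches s c [::] c' -> current c' = Halt b -> holds c T ->
  exists T', [/\ runs lift s (cstate c) T b T', holds c' T' &
    forall j, (forall i, e i <> j) -> T' j = T j].
Proof.
move Ew: [::] => w r; elim: r T Ew => {s c w c'}
  [c|s c [q a] w c' E _ IH|//] T Ew E' hT.
  exists T; split=> //; apply: runs_halt => /=; rewrite (lift_current hT).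
  by rewrite -/(current c) E'.
have [|T' [r hT' T'E]] := IH (act (fun j =>
  if [pick i | e i == j] is Some i then (enc_symbol (a i).1, (a i).2)
  else (heads T j, Stay)) T) Ew E'.
  by move=> i; rewrite /act pick_e /= ffunE cells_write_move enc_tape_act hT.
exists T'; split=> //.
  apply: runs_step r => /=; rewrite (lift_current hT).
  by rewrite -/(current c) E.
move=> j hj; rewrite T'E // /act; case: pickP => [i /eqP/hj //|_].
by rewrite /heads vact_stay.
Qed.

End Lift.

(** * Programs with three main tapes and their compilation to machines *)

Section ThreeTapes.

Variables (J G : finType).

(** The three main tapes carry arguments and results; [J] supplies private scratch tapes for
    embedded machines. *)
Definition tape_index : Type := ('I_3 + J)%type.
HB.instance Definition _ := Finite.on tape_index.

Definition three T (t0 t1 t2 : T) (r : J -> T) (j : tape_index) : T :=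
  match j with inl k => nth t2 [:: t0; t1] k | inr k => r k end.

Lemma three_eta T (f : tape_index -> T) t0 t1 t2 r :
  f (inl (@Ordinal 3 0 isT)) = t0 -> f (inl (@Ordinal 3 1 isT)) = t1 ->
  f (inl (@Ordinal 3 2 isT)) = t2 -> (forall j, f (inr j) = r j) ->
  f = three t0 t1 t2 r.
Proof.
move=> h0 h1 h2 h; apply: funext => -[[[|[|[|//]]] i]|j] //=.
- by rewrite -h0; congr (f (inl _)); apply: val_inj.
- by rewrite -h1; congr (f (inl _)); apply: val_inj.
- by rewrite -h2; congr (f (inl _)); apply: val_inj.
Qed.

Definition prog3 (S : finType) (q0 : S)
    (d : S -> symbol G -> symbol G -> symbol G -> bool + S *
      ((symbol G * direction) * (symbol G * direction) * (symbol G * direction)))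
    : prog tape_index G :=
  @Prog _ _ S q0 (fun q r =>
    match d q (r (inl (@Ordinal 3 0 isT))) (r (inl (@Ordinal 3 1 isT)))
            (r (inl (@Ordinal 3 2 isT))) with
    | inl b => inl b
    | inr (q', (a0, a1, a2)) =>
        inr (q', three a0 a1 a2 (fun j => (r (inr j), Stay)))
    end).

Lemma prog3_halt (S : finType) (q0 : S) d (q : S) t0 t1 t2 r b :
  d q (t0 0%R) (t1 0%R) (t2 0%R) = inl b ->
  runs (prog3 q0 d) 0 q (three t0 t1 t2 r) b (three t0 t1 t2 r).
Proof. by move=> e; apply: runs_halt; rewrite /= /heads /= e. Qed.

Lemma prog3_step (S : finType) (q0 : S) d (q q' : S) t0 t1 t2 r b a0 a1 a2 s T' :
  d q (t0 0%R) (t1 0%R) (t2 0%R) = inr (q', (a0, a1, a2)) ->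
  runs (prog3 q0 d) s q' (three (vact a0 t0) (vact a1 t1) (vact a2 t2) r) b T' ->
  runs (prog3 q0 d) s.+1 q (three t0 t1 t2 r) b T'.
Proof.
move=> e h; apply: runs_step; first by rewrite /= /heads /= e.
rewrite (_ : act _ _ = three (vact a0 t0) (vact a1 t1) (vact a2 t2) r) //.
by apply: three_eta => // j; rewrite /act /= vact_stay.
Qed.

Definition tapes_of (args : seq word) : tape_index -> vtape G :=
  fun j => match j with
  | inl k => wtape (nth [::] args k) | inr _ => wtape [::] end.

Definition to_index (i : 'I_(3 + #|J|)) : tape_index :=
  match split i with inl k => inl k | inr k => inr (enum_val k) end.

Definition of_index (j : tape_index) : 'I_(3 + #|J|) :=
  unsplit (match j with inl k => inl k | inr x => inr (enum_rank x) end).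

Lemma of_indexK : cancel of_index to_index.
Proof. by move=> [k|x]; rewrite /to_index unsplitK // enum_rankK. Qed.

Variable P : prog tape_index G.

Definition compile : machine :=
  @Machine (2 + #|J|) G (pstate P) (pstart P) (fun q r =>
    match pdelta q (fun j => r (of_index j)) with
    | inl b => Halt b
    | inr a => Step (a.1, [ffun i => a.2 (to_index i)])
    end).

Lemma compile_deterministic : deterministic compile.
Proof. by move=> q r a0 a1 /=; case: pdelta. Qed.

Definition tapes (c : config compile) : tape_index -> vtape G :=
  fun j => cells (ctape c (of_index j)).

Lemma compile_runs s q T b T' (c : config compile) :
  runs P s q T b T' -> cstate c = q -> tapes c = T ->
  exists c', [/\ reaches s c [::] c', current c' = Halt b & tapes c' = T'].
Proof.
have cE (d : config compile) :
    (fun j => [ffun i => cur (ctape d i)] (of_index j)) = heads (tapes d).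
  by apply: funext => j; rewrite ffunE.
move=> r; elim: r c => {s q T b T'} [q T b e|s q T q' a b T' e _ IH] c cq cT.
  exists c; split=> //; first exact: reaches_refl.
  by rewrite /current /= cE cq cT e.
have E : current c = Step (q', [ffun i => a (to_index i)]).
  by rewrite /current /= cE cq cT e.
have [//||c' [r' cH cT']] := IH (perform c (q', [ffun i => a (to_index i)])).
  apply: funext => j; rewrite /tapes /act /= !ffunE cells_write_move of_indexK.
  by rewrite -cT.
by exists c'; split=> //; apply: reaches_step E r'.
Qed.

Lemma compile_init args : size args <= 3 ->
  tapes (init compile args) = tapes_of args.
Proof.
move=> h; apply: funext => -[k|x]; rewrite /tapes /init /= ffunE cells_word //.
by rewrite nth_default //= (leq_trans h) ?leq_addr.
Qed.

Lemma compile_reaches args n b T' : size args <= 3 ->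
  runs_in P n (tapes_of args) b T' ->
  exists s (c : config compile), [/\ s <= n, reaches s (init compile args) [::] c,
    current c = Halt b & tapes c = T'].
Proof.
move=> hs [s hn r]; have [//||c [h1 h2 h3]] := compile_runs (c := init compile args) r.
  exact: compile_init.
by exists s, c.
Qed.

Lemma output_shows (c : config compile) u :
  shows (tapes c (inl ord0)) u -> output c = u.
Proof.
move=> h; apply: (shows_inj _ h).
rewrite /output (_ : ord0 = of_index (inl ord0)); first exact: shows_word_of_tape.
exact: val_inj.
Qed.

End ThreeTapes.

(** * Elementary programs on words *)

Section Primitives.

Variables (J G : finType).
Implicit Types (t : vtape G) (r : J -> vtape G) (w : word).

Definition bit_of (s : symbol G) : option bool :=
  if s is Some (inl b) then Some b else None.

Lemma bit_of_shows t u : shows t u -> bit_of (t 0%R) = ohead u.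
Proof.
case: u => [|b u] /=; last by case=> ->.
by rewrite /bit_of; case: (t 0%R) => [[b|g]|] // /(_ b).
Qed.

(** The state keeps the popped bit until it is returned as the answer. A missing bit reads as
    [false], in accordance with [head false]. *)
Definition pop_tape1 : prog (tape_index J) G :=
  prog3 J None (fun q s0 s1 s2 => if q is Some b then inl b else
    inr (Some (odflt false (bit_of s1)), ((s0, Stay), (None, MoveRight), (s2, Stay)))).

Definition pop_tape2 : prog (tape_index J) G :=
  prog3 J None (fun q s0 s1 s2 => if q is Some b then inl b else
    inr (Some (odflt false (bit_of s2)), ((s0, Stay), (s1, Stay), (None, MoveRight)))).

Lemma pop_tape1_runs t0 w t2 r :
  runs_in pop_tape1 1 (three t0 (wtape w) t2 r) (head false w)
    (three t0 (wtape (behead w)) t2 r).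
Proof.
exists 1 => //; apply: prog3_step => //.
rewrite !vact_stay vact_pop.
rewrite (bit_of_shows (shows_wtape _ w)) [odflt _ _](_ : _ = head false w); last by case: w.
exact: prog3_halt.
Qed.

Lemma pop_tape2_runs t0 t1 w r :
  runs_in pop_tape2 1 (three t0 t1 (wtape w) r) (head false w)
    (three t0 t1 (wtape (behead w)) r).
Proof.
exists 1 => //; apply: prog3_step => //.
rewrite !vact_stay vact_pop.
rewrite (bit_of_shows (shows_wtape _ w)) [odflt _ _](_ : _ = head false w); last by case: w.
exact: prog3_halt.
Qed.

Definition compare : prog (tape_index J) G :=
  prog3 J tt (fun _ s0 s1 s2 =>
    if (bit_of s0 == bit_of s1) && (bit_of s0 == bit_of s2) then
      if bit_of s0 is Some _ then
        inr (tt, ((s0, MoveRight), (s1, MoveRight), (s2, MoveRight)))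
      else inl true
    else inl false).

(** All heads advance together and the run stops at the first disagreement or at the common end, so
    [size v] bounds the time without any assumption on the other lengths. *)
Lemma compare_runs t0 t1 t2 r u v w :
  shows t0 u -> shows t1 v -> shows t2 w ->
  exists T', runs_in compare (size v) (three t0 t1 t2 r) ((u == v) && (u == w)) T'.
Proof.
elim: u v w t0 t1 t2 => [|a u IH] v w t0 t1 t2 h0 h1 h2;
  have := (bit_of_shows h0, bit_of_shows h1, bit_of_shows h2) => -[[b0 b1] b2].
  exists (three t0 t1 t2 r), 0 => //; apply: prog3_halt; rewrite b0 b1 b2.
  by case: v {h1 b1} => [|??]; case: w {h2 b2} => [|??].
case: v h1 b1 => [|b v] h1 b1.
  exists (three t0 t1 t2 r), 0 => //; apply: prog3_halt; by rewrite b0 b1.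
case: w h2 b2 => [|c w] h2 b2.
  exists (three t0 t1 t2 r), 0 => //; apply: prog3_halt; rewrite b0 b1 b2 /=.
  by rewrite !andbF.
case E : ((a == b) && (a == c)); last first.
  exists (three t0 t1 t2 r), 0 => //; apply: prog3_halt; rewrite b0 b1 b2 /=.
  rewrite !(inj_eq Some_inj) E !eqseq_cons; congr inl.
  by move: E; case: (a == b); case: (a == c); rewrite //= andbF.
case: h0 h1 h2 => [_ h0] [_ h1] [_ h2].
have [T' [s hs rs]] := IH _ _ _ _ _ h0 h1 h2.
exists T', s.+1; first by [].
rewrite !eqseq_cons; case/andP: (E) => -> ->.
apply: prog3_step; first by rewrite b0 b1 b2 /= !(inj_eq Some_inj) E.
by rewrite !vact_move.
Qed.

Lemma andthen_compare_runs A m T b T1 u v w :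
  runs_in A m T b T1 -> shows (T1 (inl (@Ordinal 3 0 isT))) u ->
  T1 (inl (@Ordinal 3 1 isT)) = wtape v -> T1 (inl (@Ordinal 3 2 isT)) = wtape w ->
  exists T', runs_in (andthen A compare) (m + size v).+1 T ((u == v) && (u == w)) T'.
Proof.
move=> rA h0 e1 e2.
have [T' r] := compare_runs (T1 \o inr) h0 (shows_wtape G v) (shows_wtape G w).
exists T'; apply: andthen_runs rA _.
by rewrite (three_eta (f := T1) erefl e1 e2 (r := T1 \o inr)).
Qed.

Lemma shift_shift (T : Type) (c d : int) (t : vtape T) :
  shift c (shift d t) = shift (c + d)%R t.
Proof. by apply: funext => k; rewrite /shift addrA. Qed.

Lemma shift0 (T : Type) (t : vtape T) : shift 0%R t = t.
Proof. by apply: funext => k; rewrite /shift addr0. Qed.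

(* Run on a word on tape 0; [None] copies, [Some false] rewinds. *)
Definition copy : prog (tape_index J) G :=
  prog3 J None (fun q s0 s1 s2 =>
    match q with
    | None =>
      if bit_of s0 is Some b then
        inr (None, ((None, MoveRight), (Some (inl b), MoveRight), (Some (inl b), MoveRight)))
      else inr (Some false, ((s0, Stay), (s1, MoveLeft), (s2, MoveLeft)))
    | Some false =>
      if bit_of s1 is Some b then
        inr (Some false, ((s0, Stay), (s1, MoveLeft), (s2, MoveLeft)))
      else inr (Some true, ((s0, Stay), (s1, MoveRight), (s2, MoveRight)))
    | Some true => inl true
    end).

Lemma vact_append b w :
  vact (Some (inl b), MoveRight) (shift (size w) (wtape w)) =
  shift (size (rcons w b)) (wtape (rcons w b)) :> vtape G.
Proof.
apply: funext => k; rewrite /vact /shift size_rcons.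
have -> : (k + Posz (size w).+1 = k + offset MoveRight + size w)%R.
  by rewrite /=; lia.
move: (k + _)%R => {}k; case: eqP => [->|hk].
  by rewrite add0r /= map_rcons nth_rcons size_map ltnn eqxx.
case E : (k + size w)%R => [n|n] //=; rewrite map_rcons nth_rcons size_map.
case: ltngtP => // hn; last by lia.
by rewrite nth_default // size_map ltnW.
Qed.

(** Here [w] is the part already copied, with both writing heads just behind it. The bound allows
    |x| steps for the rest, |w| + |x| for the rewind and two for the turns. *)
Lemma copy_loop x w r :
  exists s, s <= (size w + size x).*2.+2 - size w /\
  runs copy s None (three (wtape x) (shift (size w) (wtape w)) (shift (size w) (wtape w)) r)
    true (three (wtape [::]) (wtape (w ++ x)) (wtape (w ++ x)) r).
Proof.
elim: x w => [|b x IH] w; last first.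
  have [s [hs h]] := IH (rcons w b); exists s.+1; split.
    by move: hs; rewrite size_rcons /=; lia.
  apply: prog3_step => //=; rewrite vact_pop vact_append /= -cat_rcons.
  exact: h.
exists (size w).+2; split; first by lia.
rewrite cats0; apply: prog3_step => //=; rewrite vact_stay !vact_move shift_shift.
(* The number [n] of cells still to be rewound is generalised, keeping only that it is at most the
   length of [w]. *)
have : size w <= size w by [].
rewrite -[in X in shift X]/(Posz _); move: {1 3 4 5}(size w) => n.
elim: n => [|n IH] hn.
  apply: prog3_step => //=; rewrite vact_stay !vact_move shift_shift /= shift0.
  exact: prog3_halt.
have e : shift (offset MoveLeft + Posz n.+1) (wtape w) 0%R =
    Some (inl (nth false w n)) :> symbol G.
  rewrite /shift (_ : 0 + (offset MoveLeft + Posz n.+1) = Posz n)%R; last by rewrite /=; lia.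
  by rewrite /= (nth_map false).
apply: prog3_step; first by rewrite e.
rewrite -e vact_stay !vact_move shift_shift.
rewrite (_ : offset MoveLeft + (offset MoveLeft + Posz n.+1) =
  offset MoveLeft + Posz n)%R; last by rewrite /=; lia.
by apply: IH; apply: ltnW.
Qed.

Lemma copy_runs x r :
  runs_in copy (size x).*2.+2 (three (wtape x) (wtape [::]) (wtape [::]) r)
    true (three (wtape [::]) (wtape x) (wtape x) r).
Proof.
have [s [hs h]] := copy_loop x [::] r; exists s; first by move: hs => /=; lia.
by move: h; rewrite /= shift0.
Qed.

(* For words u on tape 1 and v on tape 2, writes 1^(|v| - |u|) 0^(|u| + 2) on
   tape 0, from right to left. *)
Definition emit : prog (tape_index J) G :=
  prog3 J None (fun q s0 s1 s2 =>
    match q with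
    | None =>
      if bit_of s1 is Some b then
        inr (None, ((Some (inl false), MoveLeft), (s1, MoveRight), (s2, MoveRight)))
      else inr (Some None, ((Some (inl false), MoveLeft), (s1, Stay), (s2, Stay)))
    | Some None =>
        inr (Some (Some false), ((Some (inl false), MoveLeft), (s1, Stay), (s2, Stay)))
    | Some (Some false) =>
      if bit_of s2 is Some b then
        inr (Some (Some false), ((Some (inl true), MoveLeft), (s1, Stay), (s2, MoveRight)))
      else inr (Some (Some true), ((s0, MoveRight), (s1, Stay), (s2, Stay)))
    | Some (Some true) => inl true
    end).

(** Under [shift (-1)] the head is on the blank just left of the word, so writing and moving left
    prepends a bit. Building the output this way needs no rewind: one final move to the right
    reaches its first bit. *)
Lemma vact_prepend b w :
  vact (Some (inl b), MoveLeft) (shift (-1) (wtape w)) =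
  shift (-1) (wtape (b :: w)) :> vtape G.
Proof.
apply: funext => k; rewrite /vact /shift [offset _]/=; move: (k + -1)%R => {}k.
case: eqP => [-> //|]; case: k => [[|n]|n] // _.
by have -> : (Posz n.+1 + -1 = Posz n)%R by lia.
Qed.

Lemma nseq_cat_cons (T : Type) n (a : T) s :
  nseq n a ++ a :: s = a :: nseq n a ++ s.
Proof. by elim: n => //= n ->. Qed.

Lemma emit_ones w v t1 t2 r : shows t2 v ->
  exists T', runs emit (size v).+1 (Some (Some false))
    (three (shift (-1) (wtape w)) t1 t2 r) true T' /\
    T' (inl ord0) = wtape (nseq (size v) true ++ w).
Proof.
elim: v w t2 => [|b v IH] w t2 h2.
  eexists; split.
    apply: prog3_step; first by rewrite /= (bit_of_shows h2).
    exact: prog3_halt.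
  by rewrite /= vact_move shift_shift /= shift0.
have [T' [h hT']] := IH (true :: w) _ h2.2.
exists T'; split.
  apply: prog3_step; first by rewrite /= (bit_of_shows h2).
  by rewrite vact_prepend vact_stay vact_move.
by rewrite hT' nseq_cat_cons.
Qed.

(** Heads 1 and 2 advance together while [u] lasts, each step writing a 0; two more zeros follow,
    and each remaining bit of [v] yields a 1. *)
Lemma emit_loop w u v t1 t2 r : shows t1 u -> shows t2 v -> size u <= size v ->
  exists T', runs emit (size v + 3) None
    (three (shift (-1) (wtape w)) t1 t2 r) true T' /\
    T' (inl ord0) = wtape (nseq (size v - size u) true ++ nseq (size u).+2 false ++ w).
Proof.
elim: u v w t1 t2 => [|a u IH] v w t1 t2 h1 h2 hs.
  have [T' [h hT']] := emit_ones (false :: false :: w) t1 r h2.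
  exists T'; split; last by rewrite subn0.
  rewrite addn3; apply: prog3_step; first by rewrite /= (bit_of_shows h1).
  rewrite vact_prepend !vact_stay; apply: prog3_step; first by [].
  by rewrite vact_prepend !vact_stay.
case: v h2 hs => // b v h2 hs.
have [T' [h hT']] := IH _ (false :: w) _ _ h1.2 h2.2 hs.
exists T'; split.
  rewrite /= addSn; apply: prog3_step; first by rewrite /= (bit_of_shows h1).
  by rewrite vact_prepend !vact_move.
by rewrite hT' /= subSS nseq_cat_cons.
Qed.

Lemma emit_runs u v t1 t2 r : shows t1 u -> shows t2 v -> size u <= size v ->
  exists T', runs_in emit (size v + 3) (three (wtape [::]) t1 t2 r) true T' /\
    shows (T' (inl ord0)) (nseq (size v - size u) true ++ nseq (size u).+2 false).
Proof.
move=> h1 h2 hs; have [T' [h hT']] := emit_loop [::] r h1 h2 hs.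
exists T'; split; last by rewrite hT' cats0; apply: shows_wtape.
exists (size v + 3) => //.
suff -> : wtape [::] = shift (-1) (wtape [::]) :> vtape G by exact: h.
have wtape_nil k : wtape [::] k = None :> symbol G by case: k => //= n; rewrite nth_nil.
by apply: funext => k; rewrite /shift !wtape_nil.
Qed.

Lemma tapes_ofE x y z :
  @tapes_of J G [:: x; y; z] =
  three (wtape x) (wtape y) (wtape z) (fun=> wtape [::]).
Proof. exact: three_eta. Qed.

End Primitives.

(** Coefficients in [nat] make polynomials monotone, so time bounds in |x| can be replaced by bounds
    in the total input length. *)
Lemma leq_horner (p : {poly nat}) m n : m <= n -> p.[m]%R <= p.[n]%R.
Proof.
move=> h; elim/poly_ind: p => [|p c IH]; first by rewrite !horner0.
by rewrite !hornerMXaddC leq_add2r leq_mul.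
Qed.

(** * Running polynomial-time machines as subroutines *)

Section Subroutines.

Variables (A : machine) (J G : finType).
Variables (scratch : 'I_(ntape A).+1 -> J) (enc : aux A -> G).
Hypotheses (scratch_inj : injective scratch) (enc_inj : injective enc).

Definition wire1 (k : 'I_3) (i : 'I_(ntape A).+1) : tape_index J :=
  if i == ord0 then inl k else inr (scratch i).

Lemma wire1_inj k : injective (wire1 k).
Proof.
move=> i j; rewrite /wire1; case: eqP => [->|_]; case: eqP => [->|_] //.
by case=> /scratch_inj.
Qed.

Lemma lift1_runs (k : 'I_3) n x u T :
  (exists s (c : config A) b, [/\ s <= n, reaches s (init A [:: x]) [::] c,
     current c = Halt b & output c = u]) ->
  T (inl k) = wtape x -> (forall i, T (inr (scratch i)) = wtape [::]) ->
  exists b T', [/\ runs_in (lift (wire1 k) enc) n T b T', shows (T' (inl k)) u &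
    forall j, j <> inl k -> (forall i, j <> inr (scratch i)) -> T' j = T j].
Proof.
case=> s [c [b [hs r cH cu]]] hk hT.
have [|T' [r' hT' hT'']] := lift_runs (wire1_inj (k := k)) enc_inj r cH (T := T).
  move=> i; rewrite /init /= ffunE cells_word enc_tape_word /wire1.
  case: eqP => [-> //|]; case: i => -[|i] hi h; last by rewrite hT /= nth_nil.
  by case: h; apply: val_inj.
exists b, T'; split.
- by exists s.
- have /= -> := hT' ord0; apply: shows_enc.
  by rewrite -cu; apply: shows_word_of_tape.
- move=> j h1 h2; apply: hT'' => i; rewrite /wire1; case: eqP => _ e.
    by apply: h1.
  by apply: (h2 i).
Qed.

(** Swapping the last two arguments tests adjacency in the opposite direction, as copies traversed
    backwards require. *)
Definition wire3 (swap : bool) (i : 'I_(ntape A).+1) : tape_index J :=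
  match val i with
  | 0 => inl (@Ordinal 3 0 isT)
  | 1 => inl (if swap then @Ordinal 3 2 isT else @Ordinal 3 1 isT)
  | 2 => inl (if swap then @Ordinal 3 1 isT else @Ordinal 3 2 isT)
  | _ => inr (scratch i)
  end.

Lemma wire3_inj swap : injective (wire3 swap).
Proof.
move=> i j e; apply: val_inj; move: e; rewrite /wire3.
case Ei : (val i) => [|[|[|?]]]; case Ej : (val j) => [|[|[|?]]] //; case: swap => //.
all: by case=> /scratch_inj h; rewrite -Ei -Ej h.
Qed.

Lemma lift3_runs (swap : bool) n x y z b :
  (exists s (c : config A), [/\ s <= n,
     reaches s (init A (if swap then [:: x; z; y] else [:: x; y; z])) [::] c
     & current c = Halt b]) ->
  exists T', runs_in (lift (wire3 swap) enc) n
    (three (wtape x) (wtape y) (wtape z) (fun=> wtape [::])) b T'.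
Proof.
case=> s [c [hs r cH]].
have [|T' [r' _ _]] := lift_runs (wire3_inj (swap := swap)) enc_inj r cH
    (T := three (wtape x) (wtape y) (wtape z) (fun=> wtape [::])).
  move=> i; rewrite /init /= ffunE cells_word enc_tape_word /wire3.
  by case: i => -[|[|[|i]]] hi; case: (swap) => //=; rewrite ?nth_nil.
by exists T', s.
Qed.

End Subroutines.

(** The input is copied to two tapes, [F] and [F'] are computed there in place, and [emit] uses only
    the lengths of the results. *)
Lemma FPt_emit (p : {poly nat}) F F' : FPt F -> FPt F' ->
  (forall x, size (F' x) = p.[size x]%R) -> (forall x, size (F x) <= size (F' x)) ->
  FPt (fun x => nseq (size (F' x) - size (F x)) true ++ nseq (size (F x)).+2 false).
Proof.
case=> A [q [_ hA]] [A' [q' [_ hA']]] hp hs.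
pose J : finType := ('I_(ntape A).+1 + 'I_(ntape A').+1)%type.
pose G : finType := (aux A + aux A')%type.
pose L := @lift A (tape_index J) G (wire1 inl (@Ordinal 3 1 isT)) inl.
pose L' := @lift A' (tape_index J) G (wire1 inr (@Ordinal 3 2 isT)) inr.
pose E := emit J G.
pose P := andthen (copy J G) (andthen L (andthen L' E)).
(* Copying takes at most 2|x| + 2 steps, [emit] at most [size (F' x) + 3], and each of the three
   compositions adds one, which makes 8. *)
exists (compile P), ('X + 'X + q + q' + p + 8%:P)%R; split.
  exact: compile_deterministic.
move=> x.
have r1 := @copy_runs J G x (fun=> wtape [::]).
have [//|//|//|//|b [T2 [r2 s2 f2]]] :=
  @lift1_runs A J G inl inl _ _ (@Ordinal 3 1 isT) _ x (F x)
    (three (wtape [::]) (wtape x) (wtape x) (fun=> wtape [::])) (hA x).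
- by move=> ?? [].
- by move=> ?? [].
have [||||b' [T3 [r3 s3 f3]]] :=
  @lift1_runs A' J G inr inr _ _ (@Ordinal 3 2 isT) _ x (F' x) T2 (hA' x).
- by move=> ?? [].
- by move=> ?? [].
- by rewrite f2.
- by move=> i; rewrite f2 // => i' [].
(* By the frame clauses tape 0 is still blank and tape 1 still holds the output of the first
   machine. *)
have T3E : T3 = three (wtape [::]) (T2 (inl (@Ordinal 3 1 isT)))
    (T3 (inl (@Ordinal 3 2 isT))) (T3 \o inr).
  by apply: three_eta => //; rewrite f3 // f2.
rewrite {}T3E in r3.
have [T4 [r4 s4]] := emit_runs (T3 \o inr) s2 s3 (hs x).
have r := andthen_runs r1 (andthen_runs r2 (andthen_runs r3 r4)).
have E0 : @tapes_of J G [:: x] =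
  three (wtape x) (wtape [::]) (wtape [::]) (fun=> wtape [::]) by exact: three_eta.
rewrite -E0 in r; have [//|t [c [ht rc cH cT]]] := compile_reaches _ r.
exists t, c, true; split=> //; last by apply: output_shows; rewrite cT.
apply: leq_trans ht _; rewrite !hornerD hornerC hornerX hp; lia.
Qed.

(** The bits [c0], [c1] are the copy number in binary. The test [d0 == c0 (+) c1], [d1 == ~~ c1]
    says that it grows by one modulo 4; the crossing lies at [t x] after a forward copy and at [b x]
    after a backward one. *)
Definition snake (b t : word -> word) (prec : word -> word -> word -> bool)
    (x y z : word) : bool :=
  let c0 := head false y in let c1 := head false (behead y) in
  let d0 := head false z in let d1 := head false (behead z) in
  let y' := behead (behead y) in let z' := behead (behead z) in
  if (d0 == c0) && (d1 == c1) then if c1 then prec x z' y' else prec x y' z'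
  else if (d0 == c0 (+) c1) && (d1 == ~~ c1) then
    ((if c1 then b x else t x) == y') && ((if c1 then b x else t x) == z')
  else false.

Lemma snake_poly_time b t prec : FPt b -> FPt t -> poly_time_pred3 prec ->
  poly_time_pred3 (snake b t prec).
Proof.
case=> B [qb [_ hB]] [T [qt [_ hT]]] [A [qa [_ hA]]].
pose J : finType := ('I_(ntape A).+1 + ('I_(ntape B).+1 + 'I_(ntape T).+1))%type.
pose G : finType := (aux A + (aux B + aux T))%type.
pose LA c1 := @lift A (tape_index J) G (wire3 inl c1) inl.
pose LB := @lift B (tape_index J) G (wire1 (inr \o inl) (@Ordinal 3 0 isT)) (inr \o inl).
pose LT := @lift T (tape_index J) G (wire1 (inr \o inr) (@Ordinal 3 0 isT)) (inr \o inr).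
pose leaf (c0 c1 d0 d1 : bool) : prog (tape_index J) G :=
  if (d0 == c0) && (d1 == c1) then LA c1
  else if (d0 == c0 (+) c1) && (d1 == ~~ c1) then
    andthen (if c1 then LB else LT) (compare J G)
  else const false.
pose P := branch (pop_tape1 J G) (fun c0 => branch (pop_tape1 J G) (fun c1 =>
  branch (pop_tape2 J G) (fun d0 => branch (pop_tape2 J G) (fun d1 =>
  leaf c0 c1 d0 d1)))).
exists (compile P), (qa + qb + qt + 'X + 20%:P)%R; split.
  exact: compile_deterministic.
move=> x y z; set n := size x + size y + size z.
pose y' := behead (behead y); pose z' := behead (behead z).
have hn : size x + size y' + size z' <= n by rewrite /n !size_behead; lia.
have hn' : size x + size z' + size y' <= n by rewrite /n !size_behead; lia.
have hx : size x <= n by rewrite /n; lia.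
have [T' hleaf] : exists T', runs_in
    (leaf (head false y) (head false (behead y)) (head false z) (head false (behead z)))
    (qa.[n] + qb.[n] + qt.[n] + n + 3)%R
    (three (wtape x) (wtape y') (wtape z') (fun=> wtape [::]))
    (snake b t prec x y z) T'.
  rewrite /leaf /snake -/y' -/z'.
  case: ifP => _.
    case: (head false (behead y)).
      have [|||T' r] := @lift3_runs A J G inl inl _ _ true qa.[n]%R x y' z' (prec x z' y').
      - by move=> ?? [].
      - by move=> ?? [].
      - have [s [c [h1 h2 h3]]] := hA x z' y'; exists s, c; split=> //.
        by apply: leq_trans h1 _; apply: leq_horner.
      by exists T'; apply: runs_in_leq r; lia.
    have [|||T' r] := @lift3_runs A J G inl inl _ _ false qa.[n]%R x y' z' (prec x y' z').
    - by move=> ?? [].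
    - by move=> ?? [].
    - have [s [c [h1 h2 h3]]] := hA x y' z'; exists s, c; split=> //.
      by apply: leq_trans h1 _; apply: leq_horner.
    by exists T'; apply: runs_in_leq r; lia.
  case: ifP => _; last first.
    exists (three (wtape x) (wtape y') (wtape z') (fun=> wtape [::])).
    by apply: runs_in_leq (const_runs _ _); lia.
  have hy' : size y' <= n by move: hn; lia.
  case: (head false (behead y)).
    have [||||//|a [T1 [r s f]]] := @lift1_runs B J G (inr \o inl) (inr \o inl) _ _
      (@Ordinal 3 0 isT) qb.[n]%R x (b x)
      (three (wtape x) (wtape y') (wtape z') (fun=> wtape [::])).
    - by move=> ?? [].
    - by move=> ?? [].
    - have [s [c [a [h1 h2 h3 h4]]]] := hB x; exists s, c, a; split=> //.
      by apply: leq_trans h1 _; apply: leq_horner.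
    - by [].
    have [||T' r'] := andthen_compare_runs (v := y') (w := z') r s; try by rewrite f.
    by exists T'; apply: runs_in_leq r'; lia.
  have [||||//|a [T1 [r s f]]] := @lift1_runs T J G (inr \o inr) (inr \o inr) _ _
    (@Ordinal 3 0 isT) qt.[n]%R x (t x)
    (three (wtape x) (wtape y') (wtape z') (fun=> wtape [::])).
  - by move=> ?? [].
  - by move=> ?? [].
  - have [s [c [a [h1 h2 h3 h4]]]] := hT x; exists s, c, a; split=> //.
    by apply: leq_trans h1 _; apply: leq_horner.
  - by [].
  have [||T' r'] := andthen_compare_runs (v := y') (w := z') r s; try by rewrite f.
  by exists T'; apply: runs_in_leq r'; lia.
have r : runs_in P (1 + (1 + (1 + (1 + (qa.[n] + qb.[n] + qt.[n] + n + 3)%R).+1).+1).+1).+1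
    (@tapes_of J G [:: x; y; z]) (snake b t prec x y z) T'.
  rewrite tapes_ofE; apply: branch_runs; first exact: pop_tape1_runs.
  apply: branch_runs; first exact: pop_tape1_runs.
  apply: branch_runs; first exact: pop_tape2_runs.
  by apply: branch_runs; first exact: pop_tape2_runs.
have [//|s [c [hs rc cH _]]] := compile_reaches _ r.
exists s, c; split=> //; apply: leq_trans hs _.
by rewrite !hornerD hornerC hornerX; lia.
Qed.

(** * Padding a nondeterministic machine *)

(** The choice word fixes every step and a halting configuration has no successor. Hence a path has
    only one answer, which makes negating it meaningful. *)
Lemma reaches_halt_inj (M : machine) s s' (c c1 c2 : config M) w b1 b2 :
  reaches s c w c1 -> current c1 = Halt b1 ->
  reaches s' c w c2 -> current c2 = Halt b2 -> c1 = c2.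
Proof.
move=> r; elim: r s' => {s c w c1} [c|s c a w c1 e _ IH|s c a0 a1 b w c1 e _ IH] s' h1 r2 h2.
- by inversion r2 as [|? ? ? ? ? e2|? ? ? ? ? ? ? e2]; subst=> //; rewrite h1 in e2.
- inversion r2 as [|? ? a' ? ? e2 r2'|? ? ? ? ? ? ? e2]; subst.
  + by move: (etrans (esym h2) e).
  + by case: (etrans (esym e2) e) => ?; subst; apply: IH r2' h2.
  + by move: (etrans (esym e2) e).
- inversion r2 as [|? ? ? ? ? e2|? ? a0' a1' ? ? ? e2 r2']; subst.
  + by move: (etrans (esym e2) e).
  + by case: (etrans (esym e2) e) => ? ?; subst; apply: IH r2' h2.
Qed.

Section Padding.

Variable M : machine.

Local Notation symbols := {ffun 'I_(ntape M).+1 -> symbol (aux M)}.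

Definition keep (r : symbols) : {ffun 'I_(ntape M).+1 -> symbol (aux M) * direction} :=
  [ffun i => (r i, Stay)].

(* Guesses two bits and then runs M; the boolean attached to a state of M
   records whether one of them was 1, in which case the path accepts anyway;
   otherwise the answer of M is negated. *)
Definition padded : machine :=
  @Machine (ntape M) (aux M) (option (bool + bool * state M)) None
    (fun q r => match q with
     | None => Branch (Some (inl false), keep r) (Some (inl true), keep r)
     | Some (inl c) =>
       Branch (Some (inr (c, start M)), keep r) (Some (inr (true, start M)), keep r)
     | Some (inr (f, q)) =>
       match delta q r with
       | Halt b => Halt (f || ~~ b)
       | Step a => Step (Some (inr (f, a.1)), a.2)
       | Branch a0 a1 => Branch (Some (inr (f, a0.1)), a0.2) (Some (inr (f, a1.1)), a1.2)
       end
     end).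

Definition embed (f : bool) (c : config M) : config padded :=
  @Config padded (Some (inr (f, cstate c))) (ctape c).

Lemma embed_current f c : current (embed f c) =
  match current c with
  | Halt b => Halt (f || ~~ b)
  | Step a => Step (Some (inr (f, a.1)), a.2)
  | Branch a0 a1 => Branch (Some (inr (f, a0.1)), a0.2) (Some (inr (f, a1.1)), a1.2)
  end.
Proof. by []. Qed.

Lemma embed_reaches f s c w c' : reaches s c w c' -> reaches s (embed f c) w (embed f c').
Proof.
elim=> {s c w c'} [c|s c a w c' e _ IH|s c a0 a1 b w c' e _ IH].
- exact: reaches_refl.
- by apply: reaches_step; first by rewrite embed_current e.
- apply: reaches_branch; first by rewrite embed_current e.
  by case: b IH.
Qed.

Lemma reaches_embed f s c w d : reaches s (embed f c) w d ->
  exists2 c', d = embed f c' & reaches s c w c'.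
Proof.
move Ec: (embed f c) => d0 r; elim: r c Ec => {s d0 w d}
  [d|s d a w d' e _ IH|s d a0 a1 b w d' e _ IH] c Ec.
- by exists c => //; apply: reaches_refl.
- move: e; rewrite -Ec embed_current; case E: (current c) => [|a'|] // [Ea].
  have [|c' -> r] := IH (perform c a'); first by rewrite -Ec -Ea.
  by exists c' => //; apply: reaches_step E r.
- move: e; rewrite -Ec embed_current; case E: (current c) => [||a0' a1'] // [Ea0 Ea1].
  have [|c' -> r] := IH (perform c (if b then a1' else a0')).
    by rewrite -Ec -Ea0 -Ea1; case: b {IH}.
  by exists c' => //; apply: reaches_branch E r.
Qed.

Lemma perform_keep (c : config padded) q :
  perform c (q, keep [ffun i => cur (ctape c i)]) = Config q (ctape c).
Proof.
rewrite /perform /=; congr Config; apply/ffunP => i; rewrite !ffunE.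
by case: (ctape c i).
Qed.

Lemma padded_reaches x s w c :
  reaches s (init M [:: x]) w c -> forall c0 c1,
  reaches s.+2 (init padded [:: x]) (c0 :: c1 :: w) (embed (c0 || c1) c).
Proof.
move=> r c0 c1; apply: reaches_branch; first by [].
have -> : (if c0 then (Some (inl true), keep [ffun i => cur (ctape (init padded [:: x]) i)])
    else (Some (inl false), keep [ffun i => cur (ctape (init padded [:: x]) i)])) =
    (Some (inl c0) : state padded, keep [ffun i => cur (ctape (init padded [:: x]) i)]).
  by case: c0.
rewrite perform_keep; apply: reaches_branch; first by [].
rewrite (_ : (if c1 then _ else _) = (Some (inr (c0 || c1, start M)) : state padded,
    keep [ffun i => cur (ctape (init padded [:: x]) i)])); last by case: c1; case: c0.
by rewrite (perform_keep (Config (Some (inl c0) : state padded) _)); apply: (embed_reaches (c0 || c1) r).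
Qed.

(** The first alternative collects the runs that are still guessing; as these have not halted, every
    complete path falls under the second. *)
Lemma reaches_padded x s w d :
  reaches s (init padded [:: x]) w d ->
  (s < 2 /\ forall b, current d <> Halt b) \/
  exists c0 c1 s' w' c, [/\ s = s'.+2, w = c0 :: c1 :: w', d = embed (c0 || c1) c &
    reaches s' (init M [:: x]) w' c].
Proof.
move=> r; inversion r as [|? ? ? ? ? e|s1 ? a0 a1 c0 w1 ? e r1]; subst; first by left.
  by [].
move: r1; case: e => <- <-.
(* The conditional on the guessed bit is moved inside the target state, so that [perform_keep]
   applies. *)
rewrite -(fun_if (fun c => (c, _))) -(fun_if (fun c : bool => Some (inl c))).
rewrite perform_keep => r1.
inversion r1 as [|? ? ? ? ? e|s2 ? a2 a3 c1 w2 ? e r2]; subst; first by left.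
  by [].
move: r2; case: e => <- <-.
rewrite -(fun_if (fun c => (c, _))) -(fun_if (fun c : bool * state M => Some (inr c))).
rewrite -(fun_if (fun c : bool => (c, _))).
rewrite (perform_keep (Config _ _)) => r2.
have [|c -> r3] := @reaches_embed (c0 || c1) s2 (init M [:: x]) w2 d.
  by move: r2; case: c0 {r r1}; case: c1.
by right; exists c0, c1, s2, w2, c.
Qed.

Lemma padded_NPTM : NPTM M -> NPTM padded.
Proof.
case=> q hq; exists (q + 2%:P)%R => x s w c /reaches_padded; rewrite hornerD hornerC.
case=> [[h _]|[c0 [c1 [s' [w' [c' [-> _ _ /hq h]]]]]]]; lia.
Qed.

Lemma padded_balanced p : balanced p M -> balanced (p + 2%:P)%R padded.
Proof.
move=> hp x w; rewrite hornerD hornerC; split.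
  case=> s [d [b [/reaches_padded[[_ h] /h //|]]]].
  case=> c0 [c1 [s' [w' [c [_ -> -> r]]]]]; rewrite embed_current => cH.
  suff /= -> : size w' = p.[size x]%R by lia.
  apply/hp; exists s', c; move: cH; case: (current c) => // b' _.
  by exists b'.
case: w => [|c0 [|c1 w]] /= h; [lia|lia|].
have /hp [s [c [b [r cH]]]] : size w = p.[size x]%R by lia.
exists s.+2, (embed (c0 || c1) c), (c0 || c1 || ~~ b).
by split; [apply: padded_reaches|apply: etrans (embed_current _ _) _; rewrite cH].
Qed.

(** Balancedness yields a halting run of [M] on [w], and its answer is unique by [reaches_halt_inj];
    so not accepting means rejecting, which is what the machine negates. *)
Lemma padded_accepting p x c0 c1 w : balanced p M -> size w = p.[size x]%R ->
  accepting_path padded x (c0 :: c1 :: w) <-> c0 || c1 \/ ~ accepting_path M x w.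
Proof.
move=> hp hw; have /hp [s [c [b [r cH]]]] := hw; split.
  case=> s1 [d [/reaches_padded[[_ h] /h //|]]].
  case=> c0' [c1' [s' [w' [c' [_ [<- <- <-] -> r']]]]]; rewrite embed_current.
  case E: (current c') => [b'||] // [].
  case: (c0 || c1) => /=; first by left.
  move=> hb; right=> -[s2 [c2 [r2 cH2]]].
  have e := reaches_halt_inj r' E r2 cH2.
  by move: hb; move: E; rewrite e cH2 => -[<-].
move=> h; exists s.+2, (embed (c0 || c1) c); split; first exact: padded_reaches.
rewrite embed_current cH; congr Halt; case: h => [->//|h].
apply/orP; right; apply/negP => hb; apply: h; exists s, c.
by rewrite hb in cH.
Qed.

End Padding.

(** * The snake order *)

Section Rank.

Variable n : nat.
Implicit Types a b : str n.

Definition rank a : nat := Order.enum_rank a.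

Lemma card_str : #|{: str n}| = 2 ^ n.
Proof. by rewrite card_tuple card_bool. Qed.

Lemma rank_lt a : rank a < 2 ^ n.
Proof. by rewrite -card_str; apply: ltn_ord. Qed.

Lemma rank_inj : injective rank.
Proof. by move=> a b /val_inj/Order.enum_rank_inj. Qed.

Lemma rank_surj k : k < 2 ^ n -> exists a, rank a = k.
Proof.
rewrite -card_str => hk; exists (Order.enum_val (Ordinal hk)).
by rewrite /rank Order.enum_valK.
Qed.

Lemma le_rank a b : (a <= b)%O = (rank a <= rank b).
Proof. by rewrite -[LHS]Order.le_enum_rank //; apply: Order.le_total. Qed.

Lemma lt_rank a b : (a < b)%O = (rank a < rank b).
Proof. by rewrite ltNge le_rank ltnNge. Qed.

(** Every number below [2 ^ n] is a rank, so a gap between two ranks would be filled by a string. *)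
Lemma lex_succ_rank a b : lex_succ a b <-> rank b = (rank a).+1.
Proof.
rewrite /lex_succ lt_rank; split.
  case/andP => hab /forallP h; apply/eqP; rewrite eqn_leq hab andbT leqNgt.
  apply/negP => hab'; have [|c hc] := @rank_surj (rank a).+1.
    by apply: ltn_trans (rank_lt b).
  by have := h c; rewrite !lt_rank hc leqnn hab'.
move=> e; rewrite e leqnn; apply/forallP => c; rewrite !lt_rank e.
by rewrite -[_ < _.+1]/(rank c < _) ltnS; case: ltnP.
Qed.

Lemma zeros_le a b : is_zeros a -> (a <= b)%O.
Proof.
move=> ha; rewrite leEsub; have : size a = size b by rewrite !size_tuple.
move: ha; rewrite /is_zeros /=; elim: (tval a) (tval b) => [|[] u IH] [|c v] //= hu [hs].
by rewrite lexi_cons; case: c => //=; apply: IH.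
Qed.

Lemma ones_ge a b : is_ones b -> (a <= b)%O.
Proof.
move=> hb; rewrite leEsub; have : size a = size b by rewrite !size_tuple.
move: hb; rewrite /is_ones /=; elim: (tval a) (tval b) => [|c u IH] [|[] v] //= hv [hs].
by rewrite lexi_cons; case: c => //=; apply: IH.
Qed.

Lemma rank_zeros a : is_zeros a <-> rank a = 0.
Proof.
split=> [h|h].
  have [|c hc] := @rank_surj 0; first by rewrite expn_gt0.
  by have := zeros_le c h; rewrite le_rank hc leqn0 => /eqP.
have z : is_zeros ([tuple of nseq n false] : str n).
  by rewrite /is_zeros /= all_nseq orbT.
suff -> : a = [tuple of nseq n false] by [].
apply: rank_inj; rewrite h; have := zeros_le a z.
by rewrite le_rank h leqn0 => /eqP.
Qed.

Lemma rank_ones a : is_ones a <-> (rank a).+1 = 2 ^ n.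
Proof.
have top c : is_ones c -> (rank c).+1 = 2 ^ n.
  move=> h; have [|d hd] := @rank_surj (2 ^ n).-1.
    by rewrite prednK // expn_gt0.
  have := ones_ge d h; rewrite le_rank hd; have := rank_lt c.
  by have := expn_gt0 2 n; lia.
split=> [|h]; first exact: top.
have o : is_ones ([tuple of nseq n true] : str n).
  by rewrite /is_ones /= all_nseq orbT.
suff -> : a = [tuple of nseq n true] by [].
by apply: rank_inj; have := top _ o; rewrite -h => -[].
Qed.

(** An injection of a finite set into itself is a permutation, so an order may be prescribed by an
    injective numbering. *)
Lemma perm_of_rank (r : str n -> nat) : injective r -> (forall a, r a < 2 ^ n) ->
  exists h : {perm (str n)}, forall a, rank (h a) = r a.
Proof.
move=> ri rlt; have hr a : r a < #|{: str n}| by rewrite card_str.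
have gi : injective (fun a => Order.enum_val (Ordinal (hr a))).
  by move=> a b /(can_inj (@Order.enum_valK _ (str n))) [] /ri.
by exists (perm gi) => a; rewrite permE /rank Order.enum_valK.
Qed.

End Rank.

Section SnakeOrder.

Variables (n : nat) (h : {perm (str n)}).

Definition tail2 (s : str n.+2) : str n := [tuple of behead [tuple of behead s]].

(* Four copies of the order [h], indexed by the first two bits; the copies whose
   second bit is 1 are traversed backwards, so consecutive copies meet at the
   same string. *)
Definition snake_pos (s : str n.+2) : nat :=
  let c0 := head false s in let c1 := head false (behead s) in
  let k := rank (h (tail2 s)) in
  (c0.*2 + c1) * 2 ^ n + (if c1 then 2 ^ n - k.+1 else k).

Lemma snake_pos_lt s : snake_pos s < 2 ^ n.+2.
Proof.
rewrite /snake_pos !expnS; have := rank_lt (h (tail2 s)).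
by case: (head _ _); case: (head _ _) => /=; lia.
Qed.

Lemma str2_eta (s : str n.+2) :
  s = head false s :: head false (behead s) :: tail2 s :> word.
Proof. by case: s => [[|c0 [|c1 s]]]. Qed.

Lemma snake_pos_inj : injective snake_pos.
Proof.
move=> s s' e; apply: val_inj; rewrite /= str2_eta [RHS]str2_eta.
have [-> -> E] : [/\ head false s = head false s',
    head false (behead s) = head false (behead s') &
    rank (h (tail2 s)) = rank (h (tail2 s'))].
  move: e (rank_lt (h (tail2 s))) (rank_lt (h (tail2 s'))); rewrite /snake_pos.
  move: (2 ^ n) (rank _) (rank _) => N k k'.
  case: (head _ s); case: (head _ (behead s)); case: (head _ s');
    case: (head _ (behead s')) => /= e hk hk'; split; lia.
by rewrite (perm_inj (rank_inj E)).
Qed.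

(** Once [b], [t] and [prec] are expressed by ranks, each of the sixteen combinations of leading
    bits is linear arithmetic. The second alternative is the return from copy 11 to copy 00, at the
    string [b x]. *)
Lemma snakeP (b t : word -> word) (prec : word -> word -> word -> bool) x :
  (forall y : str n, b x = y -> is_zeros (h y)) ->
  (forall y : str n, t x = y -> is_ones (h y)) ->
  size (b x) = n -> size (t x) = n ->
  (forall y z : str n, prec x y z <-> lex_succ (h y) (h z)) ->
  forall y z : str n.+2, snake b t prec x y z <->
    snake_pos z = (snake_pos y).+1 \/
    ((snake_pos y).+1 = 2 ^ n.+2 /\ snake_pos z = 0).
Proof.
move=> hb ht sb st hprec y z; rewrite /snake !expnS.
have P (y' z' : str n) : prec x y' z' <-> rank (h z') = (rank (h y')).+1.
  by rewrite hprec; apply: lex_succ_rank.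
have TP (y' : str n) : (t x == y') <-> (rank (h y')).+1 = 2 ^ n.
  rewrite -rank_ones; split=> [/eqP|hy]; first exact: ht.
  have ht' := ht (Tuple (introT eqP st)) erefl.
  apply/eqP; suff <- : Tuple (introT eqP st) = y' by [].
  apply: (perm_inj (s := h)); apply: rank_inj.
  by move: ht' hy; rewrite !rank_ones => <- [].
have BP (y' : str n) : (b x == y') <-> rank (h y') = 0.
  rewrite -rank_zeros; split=> [/eqP|hy]; first exact: hb.
  have hb' := hb (Tuple (introT eqP sb)) erefl.
  apply/eqP; suff <- : Tuple (introT eqP sb) = y' by [].
  apply: (perm_inj (s := h)); apply: rank_inj.
  by move: hb' hy; rewrite !rank_zeros => -> ->.
have -> : behead (behead y) = tail2 y by [].
have -> : behead (behead z) = tail2 z by [].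
have := (P (tail2 y) (tail2 z), P (tail2 z) (tail2 y)) => -[Pyz Pzy].
have := (TP (tail2 y), TP (tail2 z), BP (tail2 y), BP (tail2 z)) => -[[[Ty Tz] By] Bz].
have := (rank_lt (h (tail2 y)), rank_lt (h (tail2 z))) => -[ly lz].
rewrite /snake_pos; move: (2 ^ n) (rank _) (rank _) ly lz Pyz Pzy Ty Tz By Bz.
move=> N k k' ly lz Pyz Pzy Ty Tz By Bz.
case: (head _ y); case: (head _ (behead y)); case: (head _ z); case: (head _ (behead z)) => /=.
all: try by split=> //; lia.
all: try by split=> [/Pyz|e]; [|apply/Pyz]; lia.
all: try by split=> [/Pzy|e]; [|apply/Pzy]; lia.
all: try by split=> [/andP[/Ty + /Tz]|e]; [|apply/andP; split; [apply/Ty|apply/Tz]]; lia.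
all: by split=> [/andP[/By + /Bz]|e]; [|apply/andP; split; [apply/By|apply/Bz]]; lia.
Qed.

(* The complement of an interval becomes an initial segment once the cycle is cut
   just after that interval. *)
Lemma snake_cut (A : {set str n}) : (#|A| <> 0 -> cluster h A) ->
  exists d K, [/\ d < 2 ^ n.+2, K < 2 ^ n.+2 & forall s : str n.+2,
    (~~ head false s && ~~ head false (behead s) && (tail2 s \in A)) =
    (K < (snake_pos s + d) %% 2 ^ n.+2)].
Proof.
move=> hA; case: (set_0Vmem A) => [->|[a aA]].
  (* For empty [A] no position may exceed [K], so [K] is the greatest one. *)
  exists 0, (2 ^ n.+2).-1; have h0 : 0 < 2 ^ n.+2 by rewrite expn_gt0.
  split; [by []|lia|] => s.
  by rewrite inE andbF addn0 modn_small ?snake_pos_lt // prednK // leqNgt snake_pos_lt.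
have [|l [u eA]] := hA; first by apply/eqP; rewrite cards_eq0; apply/set0Pn; exists a.
move: aA; rewrite eA inE !le_rank => /andP[la au].
have := (rank_lt (h u), leq_trans la au) => -[hu lu].
(* In copy 00 positions are ranks. The rotation sends [(rank (h u)).+1] to 0, so the interval fills
   the last [(rank (h u) - rank (h l)).+1] positions and [K] is the one just before them. *)
exists (2 ^ n.+2 - (rank (h u)).+1), (2 ^ n.+2 - (rank (h u) - rank (h l)).+2).
rewrite !expnS; split; [lia|lia|] => s; rewrite inE !le_rank /snake_pos.
move: (rank_lt (h (tail2 s))); move: (rank (h (tail2 s))) => k.
move: {la au} (rank (h l)) (rank (h u)) (2 ^ n) hu lu => l' u' N hu lu hk.
have modE p : p < 2 * (2 * N) -> (p + (2 * (2 * N) - u'.+1)) %% (2 * (2 * N)) =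
    if p <= u' then p + (2 * (2 * N) - u'.+1) else p - u'.+1.
  move=> hp; case: leqP => hpu; first by rewrite modn_small //; lia.
  rewrite (_ : p + _ = p - u'.+1 + 2 * (2 * N)); last by lia.
  by rewrite modnDr modn_small //; lia.
case: (head _ s); case: (head _ (behead s)); rewrite /= modE; try lia.
all: by case: ifP => ?; lia.
Qed.

End SnakeOrder.

(** * Complementing clusters and functions *)

Lemma snake_circular n m (h : {perm (str n)}) (A : {set str n}) (A' : {set str m})
    (b t : word -> word) (prec : word -> word -> word -> bool) x :
  m = n.+2 ->
  (forall (s : str m) c0 c1 (w : str n), s = c0 :: c1 :: w :> word ->
     s \in A' <-> c0 || c1 \/ w \notin A) ->
  (forall y : str n, b x = y -> is_zeros (h y)) ->
  (forall y : str n, t x = y -> is_ones (h y)) ->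
  size (b x) = n -> size (t x) = n ->
  (forall y z : str n, prec x y z <-> lex_succ (h y) (h z)) ->
  (#|A| <> 0 -> cluster h A) ->
  exists h' : {perm (str m)}, [/\
    forall y z : str m, snake b t prec x y z <->
      lex_succ (h' y) (h' z) \/ (is_ones (h' y) /\ is_zeros (h' z)),
    cluster h' A' & 2 ^ m - #|A| = #|A'|].
Proof.
(* The length [m] is a variable because the value of [p + 2%:P] equals [n.+2] only by a proved
   equation. *)
move=> ?; subst m => hA' hb ht sb st hprec hA.
have [d [K [hd hK cut]]] := snake_cut hA.
set N := 2 ^ n.+2 in hd hK cut *.
(* The new order reads the snake from the cut on. The cut depends on the accepting paths, but it
   need not be computed, as rotation preserves cyclic adjacency. *)
pose r (s : str n.+2) := (snake_pos h s + d) %% N.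
have rE (s : str n.+2) : r s = if snake_pos h s + d < N then snake_pos h s + d else snake_pos h s + d - N.
  rewrite /r; case: ltnP => hs; first exact: modn_small.
  have hp : snake_pos h s < N by apply: snake_pos_lt.
  by rewrite -{1}(subnK hs) modnDr modn_small //; lia.
have [|s|h' h'E] := @perm_of_rank _ r.
- move=> s s'; rewrite !rE => e; apply: (@snake_pos_inj _ h).
  have := (snake_pos_lt h s, snake_pos_lt h s'); rewrite -/N => -[? ?].
  by move: e; do 2 case: ifP => ?; lia.
- by rewrite /r ltn_mod; lia.
have A'E (s : str n.+2) : (s \in A') = (r s <= K).
  rewrite leqNgt -cut; apply/idP/idP => [/(hA' _ _ _ _ (str2_eta s))|hs].
    by case: (head _ s); case: (head _ (behead s)) => //= -[].
  by apply/(hA' _ _ _ _ (str2_eta s)); move: hs;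
    case: (head _ s); case: (head _ (behead s)) => //=; auto.
exists h'; split.
- move=> y z; rewrite (snakeP hb ht sb st hprec) lex_succ_rank rank_ones rank_zeros !h'E !rE -/N.
  have := (snake_pos_lt h y, snake_pos_lt h z); rewrite -/N => -[? ?].
  by do 2 case: ifP => ?; lia.
- have [|l hl] := @rank_surj n.+2 0; first by rewrite expn_gt0.
  have [u hu] := rank_surj hK.
  exists (h'^-1 l)%g, (h'^-1 u)%g; apply/setP => s.
  by rewrite inE A'E !permKV !le_rank hl hu h'E.
(* The strings missing from [A'] form the image of [A] under prefixing 00. *)
- pose g (w : str n) : str n.+2 := [tuple of false :: false :: w].
  have gi : injective g by move=> w w' [] /val_inj.
  rewrite /N -card_str -(cardsC (g @: A)) card_imset // addKn; apply: eq_card => s.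
  rewrite inE A'E leqNgt -cut; congr negb; apply/imsetP/idP => [[w hw ->]|].
    by rewrite /= (_ : tail2 _ = w) //; apply: val_inj.
  case/andP=> hs hA2; exists (tail2 s) => //; apply: val_inj; rewrite /= str2_eta.
  by case/andP: hs => /negbTE -> /negbTE ->.
Qed.

(** The function [b] is returned because its length makes p(|x|) available to a machine; the bound
    on [f] keeps the truncated subtraction exact. *)
Lemma circular_complement f : CLUsharpP f ->
  exists (p : {poly nat}) (b : word -> word), [/\ FPt b,
    forall x, size (b x) = p.[size x]%R, forall x, f x <= 2 ^ p.[size x]%R &
    CLUsharpP_circular (fun x => 2 ^ (p.[size x]%R).+2 - f x)].
Proof.
case=> p [M [b [t [prec [[hM bM] hb ht hprec hf]]]]].
exists p, b; split=> //.
- by move=> x; have [h [[]]] := hf x.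
- move=> x; have [h [_ _ _ _ ->]] := hf x.
  by rewrite -card_str; apply: max_card.
exists (p + 2%:P)%R, (padded M), (snake b t prec); split.
- by split; [apply: padded_NPTM|apply: padded_balanced].
- exact: snake_poly_time.
move=> x; have [h [[sb st] [hb' ht'] hp hc fE]] := hf x.
have e : (p + 2%:P).[size x]%R = (p.[size x]%R).+2 by rewrite hornerD hornerC; lia.
have [||h' [h1 h2 h3]] := @snake_circular _ _ h (acc p M x) (acc (p + 2%:P)%R (padded M) x)
  b t prec x e _ hb' ht' sb st hp.
- move=> s c0 c1 w sE; rewrite !inE sE asboolE; apply: iff_trans (padded_accepting _ _ bM _) _.
    by rewrite size_tuple.
  by split=> -[h0|/asboolPn h0]; [left|right|left|right].
- by rewrite -fE.
exists h'; split=> //; by rewrite -h3 -fE e.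
Qed.


(** Reading i ones multiplies the accumulator plus one by 2^i, and reading i zeros multiplies the
    accumulator by 2^i. Positivity of [j] supplies the leading 1. *)
Lemma binary_numeral_nseq j k : 0 < j ->
  binary_numeral (nseq j true ++ nseq k false) (2 ^ (j + k) - 2 ^ k).
Proof.
case: j => // j _; apply/andP; split=> //.
have ones i m : (foldl (fun (m : nat) (b : bool) => m.*2 + b) m (nseq i true)).+1 = m.+1 * 2 ^ i.
  by elim: i m => [|i IH] m /=; rewrite ?expn0 ?IH ?expnS; lia.
have zeros i m : foldl (fun (m : nat) (b : bool) => m.*2 + b) m (nseq i false) = m * 2 ^ i.
  by elim: i m => [|i IH] m /=; rewrite ?expn0 ?IH ?expnS; lia.
have e := ones j.+1 0; rewrite mul1n in e.
by rewrite foldl_cat zeros expnD -[X in _ - X]mul1n -mulnBl -e subn1.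
Qed.

Theorem theorem5p5 :
  (forall f : word -> nat, CLUsharpP f <-> CLUsharpP_circular f) ->
  forall f : word -> nat, CLUsharpP f ->
    exists g : word -> nat,
      [/\ FPt_nat g, forall x, 0 < g x & CLUsharpP (fun x => f x + g x)].
Proof.
move=> eqCLU f /circular_complement[p [b [hb sb fle /eqCLU]]].
case/circular_complement=> q [b' [hb' sb' fle' /eqCLU hf]].
have pq (x : word) : p.[size x]%R + 2 <= q.[size x]%R.
  rewrite leqNgt; apply/negP => lt_qp.
  (* Otherwise 2^q would be at most 2 * 2^p, although it bounds 2^(p+2) - f(x), which is at least 3
     * 2^p. *)
  have := leq_pexp2l (ltn0Sn 1) (_ : q.[size x]%R <= p.[size x]%R.+1).
  have := fle x; have := fle' x; have := expn_gt0 2 p.[size x]%R; rewrite !expnS; lia.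
pose g (x : word) := 2 ^ q.[size x]%R.+2 - 2 ^ p.[size x]%R.+2.
have lt_pq (x : word) : 2 ^ p.[size x]%R.+2 < 2 ^ q.[size x]%R.+2.
  by rewrite ltn_exp2l //; have := pq x; lia.
exists g; split.
- exists (fun x => nseq (size (b' x) - size (b x)) true ++ nseq (size (b x)).+2 false).
  split; first by apply: (FPt_emit hb hb' sb') => x; rewrite sb sb'; have := pq x; lia.
  move=> x; rewrite sb sb' /g.
  have -> : q.[size x]%R.+2 = q.[size x]%R - p.[size x]%R + p.[size x]%R.+2.
    by have := pq x; lia.
  by apply: binary_numeral_nseq; have := pq x; lia.
- by move=> x; rewrite /g subn_gt0.
(* All truncated subtractions are exact, since f(x) <= 2^p and 2^(p+2) < 2^(q+2). *)
- congr CLUsharpP: hf; apply: funext => x; rewrite /g.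
  have := (fle x, lt_pq x) => -[].
  rewrite !(expnS 2 p.[size x]%R.+1) !(expnS 2 p.[size x]%R); lia.
Qed.
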